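(* Let $E$ be a Banach space, let $\varphi:\mathbb R_+\to\mathbb R_+$ be measurable, let $\boldsymbol X=(X_j)_{j\in\mathbb N}$ be a sequence of independent symmetric real random variables with law $\mu$, let $\mathbb X=[\boldsymbol X_1,\boldsymbol X_2,\ldots]$ be a matrix whose columns are independent copies of $\boldsymbol X$, and let $\mathbb S$ be a Rademacher matrix independent of $[\boldsymbol X,\mathbb X]$. (U) If $E\in\mathcal R_U(\mu,\varphi)$ with constant $c$, then for every $E$-valued finitely supported symmetric function $f=(f_{\alpha})$ vanishing on diagonals, $$\mathbb E\varphi\big(\|P_f(\boldsymbol X\mathbb S)\|\big)\le \mathbb E\varphi\big(\|P_f(c\,\mathbb X)\|\big)=\mathbb E\varphi\big(\|P_f(c\,\mathbb S\mathbb X)\|\big).$$ (L) If $E\in\mathcal R_L(\mu,\varphi)$ with constant $c$, then for every such $f$ the reverse inequality holds with $c$ replaced by $c^{-1}$: $$\mathbb E\varphi\big(\|P_f(\boldsymbol X\mathbb S)\|\big)\ge \mathbb E\varphi\big(\|P_f(c^{-1}\mathbb X)\|\big)=\mathbb E\varphi\big(\|P_f(c^{-1}\mathbb S\mathbb X)\|\big).$$ If, additionally, $\varphi$ is convex, then in case (U) the inequality is fulfilled also for tetrahedral functions $f$; respectively, in case (L), the fulfillment of the reverse inequality for tetrahedral functions implies the same for symmetric functions.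
   Context: Matrices have columns indexed by $k\in\mathbb N$ and rows by $j\in\mathbb N$; $X_{kj}$ is the $j$-th entry of the $k$-th column. A Rademacher matrix $\mathbb S=(\varepsilon_{kj})$ has independent entries equal to $\pm1$ with probability $1/2$. $\mathbb S\mathbb X$ is the entrywise product, and $\boldsymbol X\mathbb S$ is the matrix whose $(k,j)$ entry is $X_j\varepsilon_{kj}$. Consider families $f=(f_\alpha)$ indexed by finite sets $\alpha\subset\mathbb N$, $f_\alpha:\mathbb N^\alpha\to E$ (with $f_\emptyset\in E$), with only finitely many nonzero values. For a matrix $\mathbb Y=(Y_{kj})$ put $$P_f(\mathbb Y)=\sum_{\alpha}\sum_{\boldsymbol i\in\mathbb N^\alpha}f_\alpha(\boldsymbol i)\prod_{k\in\alpha}Y_{k,i_k}.$$ ''Vanishing on diagonals'': $f_\alpha(\boldsymbol i)=0$ if two coordinates of $\boldsymbol i$ coincide. ''Symmetric'': each $f_\alpha$ is invariant under permutations of the coordinates in $\alpha$. ''Tetrahedral'': $f_\alpha(\boldsymbol i)$ may be nonzero only if $\alpha=\{1,\dots,|\alpha|\}$ and $i_1<\dots<i_{|\alpha|}$. $\mathcal R_U(\mu,\varphi)$ (resp. $\mathcal R_L(\mu,\varphi)$) is the class of Banach spaces $E$ for which there is a constant $c>0$ such that, for $X$ any component $X_j$ of $\boldsymbol X$, $X^{(1)},X^{(2)},\ldots$ independent copies of $X$, and $(\varepsilon_i)$ a Rademacher sequence independent of $X$, $$\mathbb E\varphi\big(\|x+X\sum_i\varepsilon_ix_i\|\big)\le\mathbb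 E\varphi\big(\|x+c\sum_iX^{(i)}x_i\|\big)$$ (resp. $\mathbb E\varphi(\|x+\sum_iX^{(i)}x_i\|)\le\mathbb E\varphi(\|x+cX\sum_i\varepsilon_ix_i\|)$) for all $x\in E$ and all finite families $\{x_i\}\subset E$. *)

(* Defs.v *)
From HB Require Import structures.
From mathcomp Require Export all_boot all_order all_fingroup all_algebra finmap.
From mathcomp Require Export all_classical all_reals all_analysis.
Export numFieldNormedType.Exports.

Set Implicit Arguments.
Unset Strict Implicit.
Unset Printing Implicit Defensive.

Import Order.TTheory GRing.Theory Num.Theory.

Local Open Scope classical_set_scope.
Local Open Scope ring_scope.

Definition sigma_of (R : realType) (J T : Type) (Y : J -> T -> R) :
    set (set T) :=
  <<s \bigcup_(j in [set: J])
        preimage_set_system setT (Y j) (@measurable _ R) >>.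

Section Independence.
Context d (T : measurableType d) (R : realType) (P : probability T R).

Definition independent_systems (I : eqType) (F : I -> set (set T)) : Prop :=
  forall (s : seq I) (A : I -> set T), uniq s ->
    (forall i, i \in s -> F i (A i)) ->
    P (\bigcap_(i in [set` s]) A i) = (\prod_(i <- s) P (A i))%E.

Definition independent_pair (F G : set (set T)) : Prop :=
  forall A B, F A -> G B -> P (A `&` B) = (P A * P B)%E.

Definition independent_rvs (I : eqType) (Y : I -> {RV P >-> R}) : Prop :=
  independent_systems
    (fun i => preimage_set_system setT (Y i) (@measurable _ R)).

Definition has_law (Y : {RV P >-> R}) (nu : probability R R) : Prop :=
  forall A : set R, measurable A -> distribution P Y A = nu A.

Definition symmetric_rv (Y : {RV P >-> R}) : Prop :=
  forall A : set R, measurable A ->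
    P (Y @^-1` A) = P ((fun w => - Y w) @^-1` A).

(* Equality of the laws on the sequence space, with its product sigma-algebra
   (the one generated by the coordinate maps). *)
Definition same_law (Y Z : nat -> {RV P >-> R}) : Prop :=
  forall B : set (nat -> R),
    sigma_of (fun (j : nat) (x : nat -> R) => x j) B ->
    P [set w | B (fun j => Y j w)] = P [set w | B (fun j => Z j w)].

Definition rademacher (I : eqType) (e : I -> {RV P >-> R}) : Prop :=
  independent_rvs e /\
  forall i, P (e i @^-1` [set 1]) = (2^-1)%:E /\
            P (e i @^-1` [set -1]) = (2^-1)%:E.

(* Matrices are written column index first. *)
Definition independent_copies (X : nat -> {RV P >-> R})
    (XX : nat -> nat -> {RV P >-> R}) : Prop :=
  independent_systems (fun k => sigma_of (fun j => XX k j : T -> R)) /\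
  forall k, same_law (XX k) X.

Definition entries (Y : nat -> nat -> {RV P >-> R}) (kj : nat * nat) :
  {RV P >-> R} := Y kj.1 kj.2.

Definition prepend_column (X : nat -> {RV P >-> R})
    (XX : nat -> nat -> {RV P >-> R}) (k : nat) : nat -> {RV P >-> R} :=
  if k is k'.+1 then XX k' else X.

Definition independent_matrices (Y Z : nat -> nat -> {RV P >-> R}) : Prop :=
  independent_pair (sigma_of (fun kj => entries Y kj : T -> R))
                   (sigma_of (fun kj => entries Z kj : T -> R)).

End Independence.

(* [mu j] is the law of the j-th component (constant in j for identically
   distributed components); the law of a sequence of independent variables is
   the product of these marginals.  Both sides of the
   inequalities depend on laws only, so quantifying over all probability spaces
   carrying the variables does not change the classes. *)
Section DecouplingClasses.
Context (R : realType) (E : completeNormedModType R)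
        (mu : nat -> probability R R) (phi : R -> R) (c : R).
Local Open Scope ereal_scope.

Definition R_U_with_constant : Prop :=
  (0 < c)%R /\
  forall (d : measure_display) (T : measurableType d) (P : probability T R)
         (j : nat) (X : {RV P >-> R}) (Xc eps : nat -> {RV P >-> R}),
    has_law X (mu j) ->
    independent_rvs Xc -> (forall i, has_law (Xc i) (mu j)) ->
    rademacher eps ->
    independent_pair P (sigma_of (fun i => eps i : T -> R))
                       (sigma_of (fun _ : unit => X : T -> R)) ->
    forall (x : E) (n : nat) (xs : 'I_n -> E),
      'E_P[fun w => phi `|x + X w *: \sum_(i < n) eps i w *: xs i|%R] <=
      'E_P[fun w => phi `|x + c *: \sum_(i < n) Xc i w *: xs i|%R].

Definition R_L_with_constant : Prop :=
  (0 < c)%R /\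
  forall (d : measure_display) (T : measurableType d) (P : probability T R)
         (j : nat) (X : {RV P >-> R}) (Xc eps : nat -> {RV P >-> R}),
    has_law X (mu j) ->
    independent_rvs Xc -> (forall i, has_law (Xc i) (mu j)) ->
    rademacher eps ->
    independent_pair P (sigma_of (fun i => eps i : T -> R))
                       (sigma_of (fun _ : unit => X : T -> R)) ->
    forall (x : E) (n : nat) (xs : 'I_n -> E),
      'E_P[fun w => phi `|x + \sum_(i < n) Xc i w *: xs i|%R] <=
      'E_P[fun w => phi `|x + (c * X w)%R *: \sum_(i < n) eps i w *: xs i|%R].

End DecouplingClasses.

Section Polynomials.
Context (R : realType) (E : completeNormedModType R).

Definition multi_index : Type := {a : {fset nat} & {ffun a -> nat}}.

Definition coef_family : Type :=
  forall a : {fset nat}, {ffun a -> nat} -> E.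

Implicit Type f : coef_family.

Definition finitely_supported f : Prop :=
  finite_set [set m : multi_index | f (tag m) (tagged m) != 0].

Definition vanishing_on_diagonals f : Prop :=
  forall (a : {fset nat}) (i : {ffun a -> nat}) (k l : a),
    k != l -> i k = i l -> f a i = 0.

Definition symmetric_family f : Prop :=
  forall (a : {fset nat}) (i : {ffun a -> nat}) (s : {perm a}),
    f a [ffun k => i (s k)] = f a i.

(* Indices start at 0, so {1, ..., |a|} becomes {0, ..., |a| - 1}. *)
Definition tetrahedral f : Prop :=
  forall (a : {fset nat}) (i : {ffun a -> nat}), f a i != 0 ->
    (forall k : nat, (k \in a) = (k < #|` a|)%N) /\
    (forall k l : a, (val k < val l)%N -> (i k < i l)%N).

(* The library sum over [set: multi_index] ranges over the nonzero terms, and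
   is the actual sum when f is finitely supported. *)
Definition P_poly f (Y : nat -> nat -> R) : E :=
  \sum_(m \in [set: multi_index])
    (\prod_(k : tag m) Y (val k) (tagged m k)) *: f (tag m) (tagged m).

Definition E_phi_poly d (T : measurableType d) (P : probability T R)
    (phi : R -> R) f (Y : nat -> nat -> T -> R) : \bar R :=
  ('E_P[fun w => phi `|P_poly f (fun k j => Y k j w)|%R])%E.

End Polynomials.

Section RandomMatrices.
Context d (T : measurableType d) (R : realType) (P : probability T R).

Definition row_product (X : nat -> {RV P >-> R})
    (S : nat -> nat -> {RV P >-> R}) (k j : nat) (w : T) : R :=
  X j w * S k j w.

Definition scaled_matrix (c : R) (Y : nat -> nat -> {RV P >-> R})
    (k j : nat) (w : T) : R := c * Y k j w.

Definition scaled_entrywise_product (c : R) (S Y : nat -> nat -> {RV P >-> R})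
    (k j : nat) (w : T) : R := c * (S k j w * Y k j w).

Context (E : completeNormedModType R) (phi : R -> R) (c : R)
  (X : nat -> {RV P >-> R}) (XX SS : nat -> nat -> {RV P >-> R}).
Local Open Scope ereal_scope.

Definition upper_decoupling (f : coef_family E) : Prop :=
  E_phi_poly P phi f (row_product X SS) <=
    E_phi_poly P phi f (scaled_matrix c XX) /\
  E_phi_poly P phi f (scaled_matrix c XX) =
    E_phi_poly P phi f (scaled_entrywise_product c SS XX).

Definition lower_decoupling (f : coef_family E) : Prop :=
  E_phi_poly P phi f (row_product X SS) >=
    E_phi_poly P phi f (scaled_matrix c^-1 XX) /\
  E_phi_poly P phi f (scaled_matrix c^-1 XX) =
    E_phi_poly P phi f (scaled_entrywise_product c^-1 SS XX).

End RandomMatrices.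

(* Main.v *)
Require Import Defs.
From mathcomp Require Import ring lra.
From mathcomp Require Import measurable_realfun.
Import Order.TTheory GRing.Theory Num.Theory.
Local Open Scope classical_set_scope.
Local Open Scope ring_scope.
Set Implicit Arguments.
Unset Strict Implicit.

(** If [f] vanishes on diagonals, no monomial of [P_f] contains two entries of the
    same row, so [P_f] is an affine function of each row of the matrix when the
    other rows are fixed ([P_poly_row_affine]).  On an affine function
    [x + \sum_k Y_(k,j) x_k] of row [j], the inequality defining the class R_U
    (resp. R_L) compares exactly the two matrices in question, because row [j] of
    one of them is [(X_j eps_(k,j))_k] and row [j] of the other consists of
    independent copies of [X_j].  In both matrices the rows are independent, so
    the rows can be exchanged one after the other, each time integrating first
    over the row being exchanged ([row_replacement]).

    Three facts support this.  Independent sub-sigma-algebras turn an expectation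
    into an iterated integral over two copies of the probability space
    ([integral_independent]), where Tonelli's theorem applies.  Disjoint groups of
    an independent family generate independent sigma-algebras
    ([independent_groups]), which gives the independence of the rows, once the
    entries of the matrix of copies, resp. the components of [X] together with the
    signs, are known to form one independent family ([independent_blocks],
    [independent_rvs_sum]).  Finally [phi] of the norm of a finite combination of
    vectors is a measurable function of its coefficients, even if [E] is not
    separable ([measurable_norm_lincomb]).

    The equality of the two right-hand sides holds because the joint law of
    independent symmetric variables is invariant under changes of sign
    ([integral_random_signs]).

    A tetrahedral family vanishes on diagonals, its multi-indices being strictly
    increasing, so the inequalities for families vanishing on diagonals
    ([upper_decoupling_diag], [lower_decoupling_diag]) contain all the
    assertions. *)

(** * Measurability of norms of linear combinations *)

Section Measurability.
Context (R : realType) (E : completeNormedModType R).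
Context d (S : measurableType d).

(** The Borel sets of [E] are of no help, since a sum of two measurable [E]-valued
    functions may fail to be measurable when [E] is not separable.  Instead the
    coefficients are approximated one at a time: the triangle inequality shows
    that [`|x + c *: v + y| < a] iff some rational [q] satisfies
    [`|x + q *: v + y| + `|c - q| * `|v| < a], and this expresses the sublevel
    set as a countable union. *)
Lemma measurable_norm_lincomb (I : Type) (r : seq I) (c : I -> S -> R)
    (v : I -> E) (x : E) :
  (forall i, measurable_fun setT (c i)) ->
  measurable_fun setT (fun s => `|x + \sum_(i <- r) c i s *: v i|).
Proof.
move=> mc; elim: r x => [|i r IH] x.
  by under eq_fun do rewrite big_nil; exact: measurable_cst.
apply: (measurability _ (RGenInftyO.measurableE R)) => _ [_ [a ->] <-].
rewrite setTI.
rewrite [X in measurable X](_ : _ = \bigcup_(q : rat)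
    [set s | `|(x + ratr q *: v i) + \sum_(j <- r) c j s *: v j|
             + `|c i s - ratr q| * `|v i| < a]).
  apply: bigcupT_measurable_rat => q.
  have mF : measurable_fun setT (fun s =>
      `|(x + ratr q *: v i) + \sum_(j <- r) c j s *: v j|
             + `|c i s - ratr q| * `|v i|).
    apply: measurable_funD; first exact: IH.
    apply: measurable_funM; last exact: measurable_cst.
    apply: measurableT_comp; first exact: normr_measurable.
    by apply: measurable_funB => //; exact: measurable_cst.
  rewrite [X in measurable X](_ : _ = setT `&` (fun s =>
      `|(x + ratr q *: v i) + \sum_(j <- r) c j s *: v j|
             + `|c i s - ratr q| * `|v i|) @^-1` `]-oo, a[%classic); last first.
    by rewrite setTI; apply/seteqP; split => s /=; rewrite in_itv.
  exact: mF.
apply/seteqP; split => s /=; rewrite ?in_itv/= big_cons.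
- set y := \sum_(j <- r) _ => ha.
  set z := x + (c i s *: v i + y) in ha.
  (* Moving c i s to q costs at most e * `|v i| twice, which fits in the gap. *)
  pose e := (a - `|z|) / (2 * (1 + `|v i|)).
  have v1 : 0 < 1 + `|v i| by rewrite ltr_pwDl.
  have e0 : 0 < e by rewrite divr_gt0 ?subr_gt0// mulr_gt0.
  have e2 : 2 * (e * (1 + `|v i|)) = a - `|z|.
    by rewrite /e; field; rewrite lt0r_neq0.
  have [q] := @rat_in_itvoo R (c i s - e) (c i s + e) ltac:(lra).
  rewrite in_itv/= => /andP[q1 q2]; exists q => //=.
  have cq : `|c i s - ratr q| <= e by rewrite ler_norml; apply/andP; split; lra.
  have -> : x + ratr q *: v i + y = z - (c i s - ratr q) *: v i.
    rewrite /z scalerBl opprB (addrC (c i s *: _)) (addrA x y).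
    by rewrite -[RHS]addrA subrKC addrAC.
  have := ler_normB z ((c i s - ratr q) *: v i); rewrite normrZ.
  have := ler_wpM2r (normr_ge0 (v i)) cq.
  have : e * `|v i| < e * (1 + `|v i|) by rewrite ltr_pM2l// ltrDr.
  by lra.
- move=> [q _]/=; set y := \sum_(j <- r) _ => ha; apply: le_lt_trans ha.
  have -> : x + (c i s *: v i + y) =
      (x + ratr q *: v i + y) + (c i s - ratr q) *: v i.
    by rewrite scalerBl (addrAC x) -[RHS]addrA subrKC -addrA (addrC y).
  by rewrite -normrZ ler_normD.
Qed.

End Measurability.

(** * Independent groups of an independent family *)

Section IndependentSigmaAlgebras.
Context d (T : measurableType d) (R : realType) (P : probability T R).

(** The sets [A] independent of [B] form a lambda-system, so Dynkin's theorem
    extends independence from a pi-system to the sigma-algebra it generates. *)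
Lemma independent_sigma_event (G : set (set T)) (B : set T) :
  G `<=` measurable -> setI_closed G -> measurable B ->
  (forall A, G A -> P (A `&` B) = (P A * P B)%E) ->
  forall A, <<s G >> A -> P (A `&` B) = (P A * P B)%E.
Proof.
move=> Gm GI mB GB.
have sGm : <<s G >> `<=` measurable.
  by apply: smallest_sub => //; exact: sigma_algebra_measurable.
apply: (@dynkin_induction _ (g_sigma_algebraType G)) => //.
- by rewrite setTI probability_setT mul1e.
- move=> A /sGm mA AB.
  rewrite setIC -setDE measureD// ?ltey_eq ?fin_num_measure// (setIC B).
  rewrite [X in (_ - X)%E]AB.
  by rewrite probability_setC// muleBl// ?mul1e// fin_num_measure.
- move=> F mF tF FB.
  have {}mF n : d.-measurable (F n) by exact: (sGm _ (mF n)).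
  have mU : d.-measurable (\bigcup_k F k) by exact: bigcupT_measurable.
  rewrite setI_bigcupl !measure_semi_bigcup//.
  + rewrite muleC -(fineK (fin_num_measure P B mB)) -nneseriesZl//.
    apply: eq_eseriesr => k _; rewrite fineK ?fin_num_measure// muleC.
    exact: FB.
  + by move=> k; exact: measurableI.
  + exact: trivIset_setIr.
  + by rewrite -setI_bigcupl; exact: measurableI.
Qed.

Lemma independent_pair_sigma (G1 G2 : set (set T)) :
  G1 `<=` measurable -> G2 `<=` measurable ->
  setI_closed G1 -> setI_closed G2 ->
  independent_pair P G1 G2 -> independent_pair P <<s G1 >> <<s G2 >>.
Proof.
move=> m1 m2 I1 I2 ind A B GA GB.
have mB : measurable B.
  by apply: smallest_sub GB => //; exact: sigma_algebra_measurable.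
apply: (independent_sigma_event m1) => // C GC.
have mC : measurable C by exact: m1.
rewrite setIC muleC; apply: (independent_sigma_event m2) GB => // D GD.
by rewrite setIC muleC; exact: ind.
Qed.

Context (I : eqType) (F : I -> set (set T)).

(** Quantifying [F i (B i)] over all [i], and not just over [s], keeps the
    witnesses of two such intersections combinable. *)
Definition finite_intersections (J : set I) : set (set T) :=
  [set A | exists (s : seq I) (B : I -> set T), [/\ uniq s,
    forall i, i \in s -> J i, forall i, F i (B i)
    & A = \bigcap_(i in [set` s]) B i]].

Hypotheses (Fm : forall i, F i `<=` measurable) (FT : forall i, F i setT)
  (FI : forall i, setI_closed (F i)).

Lemma finite_intersections_measurable J :
  finite_intersections J `<=` measurable.
Proof.
move=> _ [s [B [_ _ FB ->]]].
by apply: fin_bigcap_measurable; [exact: finite_seq|move=> i _; exact: Fm].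
Qed.

Lemma finite_intersections_setI J : setI_closed (finite_intersections J).
Proof.
move=> _ _ [s [B [us sJ FB ->]]] [t [C [ut tJ FC ->]]].
pose B' i := if i \in s then B i else setT.
pose C' i := if i \in t then C i else setT.
exists (undup (s ++ t)), (fun i => B' i `&` C' i); split.
- exact: undup_uniq.
- by move=> i; rewrite mem_undup mem_cat => /orP[/sJ|/tJ].
- by move=> i; apply: FI; rewrite /B' /C'; case: ifP.
- apply/seteqP; split => w.
    move=> [Bw Cw] i _; rewrite /B' /C'.
    by split; case: ifP => // ?; [exact: Bw|exact: Cw].
  move=> h; split=> i /= hi; have := h i; rewrite /= mem_undup mem_cat.
    by rewrite /B' hi => /(_ isT)[].
  by rewrite orbC /C' hi => /(_ isT)[].
Qed.

Lemma sub_finite_intersections J :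
  \bigcup_(i in J) F i `<=` finite_intersections J.
Proof.
move=> A [i Ji FA].
exists [:: i], (fun k => if k == i then A else setT); split => //.
- by move=> k; rewrite inE => /eqP ->.
- by move=> k; case: eqP => [->|].
- apply/seteqP; split => w /=.
    by move=> Aw k; rewrite /= inE => /eqP ->; rewrite eqxx.
  by move=> /(_ i); rewrite /= inE eqxx; apply.
Qed.

(** The coalition principle: the finite intersections of events of each group
    form a pi-system, and for two disjoint groups the product rule of the family
    splits along the concatenation of the two index lists. *)
Lemma independent_groups (J K : set I) :
  independent_systems P F -> J `&` K = set0 ->
  independent_pair P <<s \bigcup_(i in J) F i >> <<s \bigcup_(i in K) F i >>.
Proof.
move=> ind JK A B JA KB.
have sub L : <<s \bigcup_(i in L) F i >> `<=` <<s finite_intersections L >>.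
  apply: sub_smallest2r; first exact: smallest_sigma_algebra.
  exact: sub_finite_intersections.
apply: (independent_pair_sigma _ _ _ _ _ (sub _ _ JA) (sub _ _ KB)).
- exact: finite_intersections_measurable.
- exact: finite_intersections_measurable.
- exact: finite_intersections_setI.
- exact: finite_intersections_setI.
move=> _ _ [s [C [us sJ FC ->]]] [t [D [ut tK FD ->]]].
have disj i : i \in t -> (i \in s) = false.
  move=> it; apply/negP => si.
  by have : (J `&` K) i by [split; [exact: sJ|exact: tK]]; rewrite JK.
pose G i := if i \in s then C i else D i.
have -> : \bigcap_(i in [set` s]) C i = \bigcap_(i in [set` s]) G i.
  by apply: eq_bigcapr => i /= si; rewrite /G si.
have -> : \bigcap_(i in [set` t]) D i = \bigcap_(i in [set` t]) G i.
  by apply: eq_bigcapr => i /= ti; rewrite /G disj.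
have FG i : F i (G i) by rewrite /G; case: ifP.
rewrite -bigcap_setU !ind// -big_cat/= -ind//.
- congr (P (bigcap _ _)); apply/seteqP; split => i /=; rewrite mem_cat.
    by move=> [->|->]; rewrite ?orbT.
  by move=> /orP.
- rewrite cat_uniq us ut andbT/=; apply/hasPn => i it.
  by rewrite /= disj.
Qed.

End IndependentSigmaAlgebras.

(** * Integration against laws of independent objects *)

Section IntegrationAgainstLaws.
Context d (T : measurableType d) (R : realType) (P : probability T R).
Local Open Scope ereal_scope.

(** The joint law of [U] and [V] agrees with the product of their laws on
    rectangles, hence everywhere, and Tonelli's theorem applies to it. *)
Lemma integral_independent_pair d1 d2 (S1 : measurableType d1)
    (S2 : measurableType d2) (U : {mfun T >-> S1}) (V : {mfun T >-> S2})
    (h : S1 * S2 -> \bar R) :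
  (forall A B, measurable A -> measurable B ->
     P (U @^-1` A `&` V @^-1` B) = P (U @^-1` A) * P (V @^-1` B)) ->
  measurable_fun setT h -> (forall z, 0 <= h z) ->
  \int[P]_w h (U w, V w) = \int[P]_w1 \int[P]_w h (U w, V w1).
Proof.
move=> ind mh h0.
pose W : {mfun T >-> (S1 * S2)%type} := mfun_Sub
  (mem_set (measurable_fun_pair (measurable_funPT U) (measurable_funPT V))).
have lawW A : measurable A ->
    distribution P W A = (distribution P U \x distribution P V) A.
  move=> mA; apply/esym/product_measure_unique => // B C mB mC; exact: ind.
transitivity (\int[distribution P W]_z h z).
  by rewrite ge0_integral_distribution.
rewrite (eq_measure_integral (distribution P U \x distribution P V)) =>
  [|A mA _]; last exact: lawW.
rewrite fubini_tonelli2//= ge0_integral_distribution//=; last 2 first.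
- exact: measurable_fun_fubini_tonelli_G.
- by move=> y; apply: integral_ge0.
apply: eq_integral => w1 _.
rewrite /fubini_G /= ge0_integral_distribution//=.
exact: measurable_fun_pair1.
Qed.

(** The form in which independence is used below: [h] need only be measurable for
    the product of the two sub-sigma-algebras, and the second copy of the sample
    point may then be frozen while integrating over the first.  It is the previous
    lemma for the identity maps from [T] to [T] with its coarser structures. *)
Lemma integral_independent (G1 G2 : set (set T)) (h : T * T -> R) :
  G1 `<=` measurable -> G2 `<=` measurable ->
  independent_pair P <<s G1 >> <<s G2 >> ->
  measurable_fun setT
    (h : g_sigma_algebraType G1 * g_sigma_algebraType G2 -> R) ->
  (forall z, (0 <= h z)%R) ->
  \int[P]_w (h (w, w))%:E = \int[P]_w1 \int[P]_w (h (w, w1))%:E.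
Proof.
move=> m1 m2 ind mh h0.
have mid (G : set (set T)) : G `<=` measurable ->
    measurable_fun setT (id : T -> g_sigma_algebraType G).
  move=> Gm _ A mA; rewrite setTI; apply: smallest_sub mA => //.
  exact: sigma_algebra_measurable.
pose U : {mfun T >-> g_sigma_algebraType G1} := mfun_Sub (mem_set (mid _ m1)).
pose V : {mfun T >-> g_sigma_algebraType G2} := mfun_Sub (mem_set (mid _ m2)).
apply: (@integral_independent_pair _ _ _ _ U V (EFin \o h)) => //.
by move/measurable_EFinP : mh.
Qed.

End IntegrationAgainstLaws.

Section CoordinateSpace.
Context (R : realType) (I : Type).

Definition coordinate_events : set (set (I -> R)) :=
  \bigcup_(i in [set: I])
    preimage_set_system setT (fun x : I -> R => x i) measurable.

Notation space := (g_sigma_algebraType coordinate_events).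

Lemma measurable_coordinate (i : I) :
  measurable_fun setT (fun x : space => x i).
Proof.
by move=> _ A mA; apply: sub_sigma_algebra; exists i => //; exists A.
Qed.

Lemma measurable_family d (T : measurableType d) (Y : I -> T -> R) :
  (forall i, measurable_fun setT (Y i)) ->
  measurable_fun setT (fun w => Y ^~ w : space).
Proof.
move=> mY; apply: (@measurability _ _ _ space _ _ coordinate_events) => //.
move=> _ [_ [i _ [B mB <-]] <-]; rewrite !setTI.
by have := mY i measurableT B mB; rewrite setTI.
Qed.

End CoordinateSpace.
Arguments coordinate_events : clear implicits.

Section LawOfIndependentFamily.
Context d (T : measurableType d) (R : realType) (P : probability T R).
Context (I : eqType).
Notation space := (g_sigma_algebraType (coordinate_events R I)).
Local Open Scope ereal_scope.

(** The marginals determine the law of an independent family, because the finite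
    intersections of coordinate events are a pi-system generating the product
    sigma-algebra. *)
Lemma integral_independent_family (Y Z : I -> {RV P >-> R}) (g : space -> R) :
  independent_rvs Y -> independent_rvs Z ->
  (forall i A, measurable A -> P (Y i @^-1` A) = P (Z i @^-1` A)) ->
  measurable_fun setT g -> (forall x, (0 <= g x)%R) ->
  \int[P]_w (g (fun i => Y i w))%:E = \int[P]_w (g (fun i => Z i w))%:E.
Proof.
move=> iY iZ YZ mg g0.
pose rv (V : I -> {RV P >-> R}) : {mfun T >-> space} := mfun_Sub
  (mem_set (measurable_family (fun i => measurable_funPT (V i)))).
pose F (i : I) := preimage_set_system setT (fun x : space => x i)
                    (@measurable _ R).
have Fm i : F i `<=` measurable.
  by move=> _ [A mA <-]; exact: measurable_coordinate.
have FT i : F i setT by exists setT; rewrite ?preimage_setT ?setTI.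
have FI i : setI_closed (F i).
  move=> _ _ [A mA <-] [B mB <-]; exists (A `&` B); first exact: measurableI.
  by rewrite !setTI.
have rvE (V : I -> {RV P >-> R}) (s : seq I) (B : I -> set space) :
    independent_rvs V -> uniq s -> (forall i, F i (B i)) ->
    distribution P (rv V) (\bigcap_(i in [set` s]) B i) =
    \prod_(i <- s) distribution P (rv V) (B i).
  move=> iV us FB; rewrite /distribution /pushforward preimage_bigcap.
  by rewrite iV// => i _; have [A mA <-] := FB i; exists A.
have lawE A : measurable A -> distribution P (rv Y) A = distribution P (rv Z) A.
  apply: (@measure_unique _ _ _ (finite_intersections F setT) (fun=> setT)).
  - apply/seteqP; split; apply: smallest_sub.
    + exact: smallest_sigma_algebra.
    + move=> A' FA'; apply: sub_sigma_algebra.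
      exact: (sub_finite_intersections FT FA').
    + exact: sigma_algebra_measurable.
    + exact: finite_intersections_measurable.
  - exact: finite_intersections_setI.
  - move=> _; exists [::], (fun=> setT); split => //.
    by rewrite set_nil bigcap_set0.
  - by apply/seteqP; split => // x _; exists 0%N.
  - move=> _ [s [B [us _ FB ->]]].
    rewrite [LHS]rvE// [RHS]rvE//; apply: eq_bigr => i _.
    have [D mD <-] := FB i; rewrite setTI; exact: YZ.
  - by move=> _; rewrite [ltLHS]probability_setT ltry.
transitivity (\int[distribution P (rv Y)]_x (g x)%:E).
  by rewrite ge0_integral_distribution//; exact/measurable_EFinP.
rewrite (eq_measure_integral (distribution P (rv Z))); last first.
  by move=> A mA _; exact: lawE.
by rewrite ge0_integral_distribution//; exact/measurable_EFinP.
Qed.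

End LawOfIndependentFamily.

(** * Polynomials as functions of one row *)

Section PolynomialsInTheRows.
Context (R : realType) (E : completeNormedModType R).

Definition monomial (m : multi_index) (Y : nat -> nat -> R) : R :=
  \prod_(k : tag m) Y (val k) (tagged m k).

Definition set_row (n : nat) (r : nat -> R) (M : nat -> nat -> R)
    (k j : nat) : R :=
  if j == n then r k else M k j.

Context (f : coef_family E).
Arguments f : clear implicits.
Hypothesis f_fin : finitely_supported f.

Definition support_of : {fset multi_index} :=
  fset_set [set m : multi_index | f (tag m) (tagged m) != 0].

Lemma P_polyE Y :
  P_poly f Y =
  \sum_(m <- support_of) monomial m Y *: f (tag m) (tagged m).
Proof.
rewrite /P_poly (fsbigTE support_of)// => m; rewrite in_fset_set// notin_setE.
by move=> /negP; rewrite negbK => /eqP ->; rewrite scaler0.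
Qed.

Lemma measurable_phi_P_poly (phi : R -> R) d (S : measurableType d)
    (Y : S -> nat -> nat -> R) :
  measurable_fun (`[0, +oo[%classic : set R) phi ->
  (forall k j, measurable_fun setT (fun s => Y s k j)) ->
  measurable_fun setT (fun s => phi `|P_poly f (Y s)|).
Proof.
move=> mphi mY.
apply: (@measurable_comp _ _ _ _ _ _ (`[0, +oo[%classic : set R)) => //.
  by move=> _ [s _ <-]; rewrite /= in_itv/= normr_ge0.
under eq_fun do rewrite P_polyE -[X in `|X|]add0r.
apply: measurable_norm_lincomb => m.
by apply: measurable_prod => k _; exact: mY.
Qed.

Lemma P_poly_row_bound : exists n, forall M M' : nat -> nat -> R,
  (forall k j, (j < n)%N -> M k j = M' k j) -> P_poly f M = P_poly f M'.
Proof.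
pose top (m : multi_index) := \max_(k : tag m) (tagged m k).
exists (\max_(m <- support_of) top m).+1 => M M' MM'.
rewrite !P_polyE; apply: eq_big_seq => m ms; congr (_ *: _).
apply: eq_bigr => k _; apply: MM'; rewrite ltnS.
apply: (@leq_trans (top m)); first exact: leq_bigmax.
exact: (@leq_bigmax_seq _ _ xpredT top).
Qed.

(** An injective multi-index meets row [n] in at most one column, so its monomial
    is either constant or proportional to a single entry of that row.  In both
    cases the coefficient of [r k] is the increment of the monomial when the row
    changes from zero to the [k]-th unit vector. *)
Lemma monomial_row_affine (m : multi_index) n K M r :
  injective (tagged m) -> (forall k : tag m, val k < K)%N ->
  monomial m (set_row n r M) = monomial m (set_row n (fun=> 0) M) +
    \sum_(k < K) r k * (monomial m (set_row n (fun l => (l == k)%:R) M)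
                        - monomial m (set_row n (fun=> 0) M)).
Proof.
move=> inj ltK.
have [/existsP[k0 /eqP k0n]|] := boolP [exists k, tagged m k == n]; last first.
  rewrite negb_exists => /forallP nn.
  have E' r' : monomial m (set_row n r' M) = monomial m M.
    by apply: eq_bigr => k _; rewrite /set_row (negbTE (nn k)).
  rewrite !E' big1 ?addr0// => k _; by rewrite E' subrr mulr0.
pose C := \prod_(k | k != k0) M (val k) (tagged m k).
have E' r' : monomial m (set_row n r' M) = r' (val k0) * C.
  rewrite /monomial (bigD1 k0)//= {1}/set_row k0n eqxx; congr (_ * _).
  apply: eq_bigr => k kk0; rewrite /set_row ifF//; apply/negbTE.
  by apply: contra kk0; rewrite -k0n => /eqP/inj ->.
rewrite !E' mul0r add0r (bigD1 (Ordinal (ltK k0)))//= big1 => [|k kk0].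
  by rewrite E' eqxx mul1r subr0 addr0.
rewrite E' (_ : (val k0 == k) = false) ?mul0r ?subr0 ?mulr0//.
by apply/negbTE; apply: contra kk0 => /eqP k0k; apply/eqP/val_inj.
Qed.

Hypothesis f_diag : vanishing_on_diagonals f.

(** This is where vanishing on diagonals enters: it leaves only injective
    multi-indices in the sum. *)
Lemma P_poly_row_affine n M : exists K (x : E) (xs : nat -> E), forall r,
  P_poly f (set_row n r M) = x + \sum_(k < K) r k *: xs k.
Proof.
pose top (m : multi_index) := \max_(k : tag m) val k.
pose K := (\max_(m <- support_of) top m).+1.
exists K, (P_poly f (set_row n (fun=> 0) M)),
  (fun k => P_poly f (set_row n (fun l => (l == k)%:R) M)
            - P_poly f (set_row n (fun=> 0) M)) => r.
rewrite !P_polyE.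
under [X in _ + X]eq_bigr => k _ do rewrite P_polyE -sumrB scaler_sumr.
rewrite exchange_big -big_split/=; apply: eq_big_seq => m ms.
under eq_bigr => k _ do rewrite -scalerBl scalerA.
rewrite -scaler_suml -scalerDl; congr (_ *: _).
apply: monomial_row_affine => [k l kl|k].
  apply/eqP/negPn/negP => kl'; move: ms; rewrite in_fset_set// in_setE/=.
  by move=> /eqP; apply; exact: f_diag kl.
rewrite ltnS.
apply: (@leq_trans (top m)); first exact: (leq_bigmax k).
exact: (@leq_bigmax_seq _ _ xpredT top).
Qed.

End PolynomialsInTheRows.

(** * Replacing the rows of a matrix one by one *)

Definition splice_rows (R : realType) (n : nat) (A M : nat -> nat -> R)
    (k j : nat) : R :=
  if (j < n)%N then A k j else M k j.

Lemma splice_rowsS (R : realType) n (A M : nat -> nat -> R) :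
  splice_rows n.+1 A M = set_row n (A ^~ n) (splice_rows n A M).
Proof.
apply/funext => k; apply/funext => j; rewrite /set_row /splice_rows ltnS.
by case: ltngtP => [||->].
Qed.

Lemma splice_set_row (R : realType) n r (A M : nat -> nat -> R) :
  splice_rows n A (set_row n r M) = set_row n r (splice_rows n A M).
Proof.
apply/funext => k; apply/funext => j; rewrite /set_row /splice_rows.
by case: ltngtP.
Qed.

Definition row_events (R : realType) (T : Type) (Y : nat -> nat -> T -> R)
    (D : set nat) : set (set T) :=
  \bigcup_(kj in [set kj | D kj.2])
    preimage_set_system setT (Y kj.1 kj.2) measurable.

Section RowReplacement.
Context d (T : measurableType d) (R : realType) (P : probability T R).
Context (E : completeNormedModType R) (phi : R -> R) (f : coef_family E).
Hypotheses (phi_ge0 : forall t, 0 <= t -> 0 <= phi t)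
  (phi_meas : measurable_fun (`[0, +oo[%classic : set R) phi)
  (f_fin : finitely_supported f) (f_diag : vanishing_on_diagonals f).
Local Open Scope ereal_scope.

Implicit Types Y Z : nat -> nat -> T -> R.

Let g (A : nat -> nat -> R) : R := phi `|P_poly f A|%R.

Let g_ge0 A : (0 <= g A)%R. Proof. by apply: phi_ge0. Qed.

Definition independent_rows Y : Prop := forall n,
  independent_pair P <<s row_events Y [set j | (j < n)%N] >>
                     <<s row_events Y [set n] >>.

Lemma row_events_measurable Y D :
  (forall k j, measurable_fun setT (Y k j)) -> row_events Y D `<=` measurable.
Proof. by move=> mY A [[k j] _ [B mB <-]]; exact: mY. Qed.

Lemma measurable_row_event Y D k j : D j ->
  measurable_fun setT (Y k j : g_sigma_algebraType (row_events Y D) -> R).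
Proof.
by move=> Dj _ A mA; apply: sub_sigma_algebra; exists (k, j) => //; exists A.
Qed.

Let mix n M Y Z (z : T * T) : R :=
  g (set_row n (fun k => Z k n z.2)
       (splice_rows n (fun k j => Y k j z.1) M)).

Let measurable_mix d1 d2 (T1 : measurableType d1) (T2 : measurableType d2)
    (Y : nat -> nat -> T1 -> R) (Z : nat -> nat -> T2 -> R) n M :
  (forall k j, (j < n)%N -> measurable_fun setT (Y k j)) ->
  (forall k, measurable_fun setT (Z k n)) ->
  measurable_fun setT (fun z : T1 * T2 =>
    g (set_row n (fun k => Z k n z.2)
       (splice_rows n (fun k j => Y k j z.1) M))).
Proof.
move=> mY mZ; apply: measurable_phi_P_poly => // k j.
rewrite /set_row /splice_rows; case: eqP => _.
  exact: measurableT_comp (mZ k) measurable_snd.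
case: ltnP => [jn|_]; last exact: measurable_cst.
exact: measurableT_comp (mY k j jn) measurable_fst.
Qed.

Let integral_splice n M Y : (forall k j, measurable_fun setT (Y k j)) ->
  independent_rows Y ->
  \int[P]_w (g (splice_rows n.+1 (fun k j => Y k j w) M))%:E =
  \int[P]_w1 \int[P]_w (mix n M Y Y (w, w1))%:E.
Proof.
move=> mY iY; under eq_integral do rewrite splice_rowsS.
apply: (@integral_independent _ _ _ P (row_events Y [set j | (j < n)%N])
  (row_events Y [set n]) (mix n M Y Y)) => //.
- exact: row_events_measurable.
- exact: row_events_measurable.
- by apply: measurable_mix => [k j jn|k]; exact: measurable_row_event.
- by move=> z; apply: g_ge0.
Qed.

(** Induction on the number [n] of random rows, the remaining ones being frozen at
    [M].  By independence row [n] may be evaluated at a second sample point [w1].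
    With [w1] fixed, row [n] is frozen and the induction hypothesis replaces the
    rows below [n]; after exchanging the integrals the rows below [n] are frozen,
    [P_f] is affine in row [n], and the comparison of single rows replaces it.
    The joint law of [Y] and [Z] never enters, as they meet only at different
    sample points. *)
Lemma row_replacement Y Z :
  (forall k j, measurable_fun setT (Y k j)) ->
  (forall k j, measurable_fun setT (Z k j)) ->
  independent_rows Y -> independent_rows Z ->
  (forall n K (x : E) (xs : nat -> E),
     \int[P]_w (phi `|x + \sum_(k < K) Y k n w *: xs k|)%:E <=
     \int[P]_w (phi `|x + \sum_(k < K) Z k n w *: xs k|)%:E) ->
  forall n M,
    \int[P]_w (g (splice_rows n (fun k j => Y k j w) M))%:E <=
    \int[P]_w (g (splice_rows n (fun k j => Z k j w) M))%:E.
Proof.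
move=> mY mZ iY iZ YZ; elim=> [|n IH] M.
  by rewrite le_eqVlt; apply/orP; left; apply/eqP/eq_integral.
rewrite (integral_splice n M mY iY) (integral_splice n M mZ iZ).
have mE A B : (forall k j, measurable_fun setT (A k j)) ->
    (forall k j, measurable_fun setT (B k j)) ->
    measurable_fun setT (fun z => (mix n M A B z)%:E).
  move=> mA mB; apply/measurable_EFinP; apply: measurable_mix => [k j _|k] //.
have mixE0 A B z : 0 <= (mix n M A B z)%:E by rewrite lee_fin; apply: g_ge0.
apply: (@le_trans _ _ (\int[P]_w1 \int[P]_w (mix n M Z Y (w, w1))%:E)).
  apply: ge0_le_integral => //.
  - by move=> w1 _; exact: integral_ge0.
  - exact: (measurable_fun_fubini_tonelli_G (fun z => (mix n M Y Y z)%:E)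
      (mE _ _ mY mY)).
  - exact: (measurable_fun_fubini_tonelli_G (fun z => (mix n M Z Y z)%:E)
      (mE _ _ mZ mY)).
  - move=> w1 _; rewrite /mix /=.
    under eq_integral do rewrite -splice_set_row.
    under [leRHS]eq_integral do rewrite -splice_set_row.
    exact: IH.
have swap A : (forall k j, measurable_fun setT (A k j)) ->
    \int[P]_w \int[P]_w1 (mix n M Z A (w, w1))%:E =
    \int[P]_w1 \int[P]_w (mix n M Z A (w, w1))%:E.
  by move=> mA; exact: (fubini_tonelli _ (mE _ _ mZ mA) (mixE0 _ _)).
rewrite -[leLHS](swap Y mY) -[leRHS](swap Z mZ).
apply: ge0_le_integral => //.
- by move=> w _; exact: integral_ge0.
- exact: (measurable_fun_fubini_tonelli_F (fun z => (mix n M Z Y z)%:E)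
    (mE _ _ mZ mY)).
- exact: (measurable_fun_fubini_tonelli_F (fun z => (mix n M Z Z z)%:E)
    (mE _ _ mZ mZ)).
- move=> w _; rewrite /mix /=.
  have [K [x [xs Mxs]]] := P_poly_row_affine f_fin f_diag n
    (splice_rows n (fun k j => Z k j w) M).
  under eq_integral do rewrite /g Mxs.
  under [leRHS]eq_integral do rewrite /g Mxs.
  exact: YZ.
Qed.

Lemma E_phi_poly_le Y Z :
  (forall k j, measurable_fun setT (Y k j)) ->
  (forall k j, measurable_fun setT (Z k j)) ->
  independent_rows Y -> independent_rows Z ->
  (forall n K (x : E) (xs : nat -> E),
     'E_P[fun w => phi `|x + \sum_(k < K) Y k n w *: xs k|%R] <=
     'E_P[fun w => phi `|x + \sum_(k < K) Z k n w *: xs k|%R]) ->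
  E_phi_poly P phi f Y <= E_phi_poly P phi f Z.
Proof.
move=> mY mZ iY iZ YZ; have [n fn] := P_poly_row_bound f_fin.
have spliceE A w : P_poly f (fun k j => A k j w) =
    P_poly f (splice_rows n (fun k j => A k j w) (fun _ _ => 0%R)) :> E.
  by apply: fn => k j jn; rewrite /splice_rows jn.
rewrite /E_phi_poly unlock.
under eq_integral do rewrite spliceE.
under [leRHS]eq_integral do rewrite spliceE.
apply: row_replacement => // m K x xs.
by have := YZ m K x xs; rewrite unlock.
Qed.

End RowReplacement.

(** * Construction of independent families *)

Section IndependentFamilies.
Context d (T : measurableType d) (R : realType) (P : probability T R).

Lemma sigma_of_reindex (T' J J' : Type) (Y : J -> T' -> R) (s : J' -> J) :
  sigma_of (fun j => Y (s j)) `<=` sigma_of Y.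
Proof.
apply: sub_smallest2r; first exact: smallest_sigma_algebra.
by move=> A [j _ YA]; exists (s j).
Qed.

Lemma sigma_of_bigcap (T' : pointedType) (J : eqType) (Y : J -> T' -> R)
    (s : seq J) (A : J -> set T') :
  (forall j, j \in s ->
    preimage_set_system setT (Y j) (@measurable _ R) (A j)) ->
  sigma_of Y (\bigcap_(j in [set` s]) A j).
Proof.
move=> YA.
apply: (@fin_bigcap_measurable _ (g_sigma_algebraType _)).
  exact: finite_seq.
by move=> j js; apply: sub_sigma_algebra; exists j => //; exact: YA.
Qed.

Lemma independent_rvs_reindex (I J : eqType) (Y : I -> {RV P >-> R})
    (s : J -> I) :
  injective s -> independent_rvs Y -> independent_rvs (fun j => Y (s j)).
Proof.
move=> sinj iY t A ut YA.
have [->|[j0 _]] : t = [::] \/ exists j0, j0 \in t.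
  by case: t {ut YA} => [|j t]; [left|right; exists j; rewrite mem_head].
  by rewrite set_nil bigcap_set0 big_nil probability_setT.
pose inv i := nth j0 t (index i (map s t)).
have invK j : j \in t -> inv (s j) = j.
  by move=> jt; rewrite /inv index_map// nth_index.
have -> : \bigcap_(j in [set` t]) A j =
    \bigcap_(i in [set` map s t]) A (inv i).
  apply/seteqP; split => w h.
    by move=> _ /= /mapP[j jt ->]; rewrite invK//; exact: h.
  move=> j jt; rewrite -(invK j)//; apply: h => /=; exact: map_f.
rewrite iY ?map_inj_uniq// ?big_map.
  by apply: eq_big_seq => j jt; rewrite invK.
by move=> _ /mapP[j jt ->]; rewrite invK//; exact: YA.
Qed.

Lemma independent_rvs_sum (I J : eqType) (U : I -> {RV P >-> R})
    (V : J -> {RV P >-> R}) :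
  independent_rvs U -> independent_rvs V ->
  independent_pair P (sigma_of (fun i => U i : T -> R))
                     (sigma_of (fun j => V j : T -> R)) ->
  independent_rvs (fun x : I + J =>
    match x with inl i => U i | inr j => V j end).
Proof.
move=> iU iV UV s A us sA.
pose s1 := pmap (fun x : I + J => if x is inl i then Some i else None) s.
pose s2 := pmap (fun x : I + J => if x is inr j then Some j else None) s.
have m1 i : (i \in s1) = (inl i \in s).
  rewrite /s1; elim: s {us sA s1 s2} => //= -[j|j] s IH; rewrite !inE.
    by rewrite IH; congr (_ || _); apply/eqP/eqP => [->|[]].
  exact: IH.
have m2 j : (j \in s2) = (inr j \in s).
  rewrite /s2; elim: s {us sA s1 s2 m1} => //= -[i|i] s IH; rewrite !inE.
    exact: IH.
  by rewrite IH; congr (_ || _); apply/eqP/eqP => [->|[]].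
have u1 : uniq s1 by apply: (@pmap_uniq _ _ _ inl) us => -[].
have u2 : uniq s2 by apply: (@pmap_uniq _ _ _ inr) us => -[].
have -> : \bigcap_(x in [set` s]) A x =
    (\bigcap_(i in [set` s1]) A (inl i)) `&`
    (\bigcap_(j in [set` s2]) A (inr j)).
  apply/seteqP; split => w.
    by move=> h; split => i /= ?; apply: h; rewrite /= -?m1 -?m2.
  move=> [h1 h2] [i|j] /= ?; first by apply: h1; rewrite /= m1.
  by apply: h2; rewrite /= m2.
rewrite UV; last 2 first.
- by apply: sigma_of_bigcap => i; rewrite m1 => /sA.
- by apply: sigma_of_bigcap => j; rewrite m2 => /sA.
rewrite iU//; last by move=> i; rewrite m1 => /sA.
rewrite iV//; last by move=> j; rewrite m2 => /sA.
rewrite /s1 /s2 {s1 s2 m1 m2 u1 u2 us sA}.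
elim: s => [|[i|j] s IH]; rewrite /= ?big_nil ?big_cons ?mule1//.
  by rewrite -IH muleA.
by rewrite -IH muleCA.
Qed.

(** The product rule is applied first across the columns, to the intersection of
    the events of each column, and then inside every column. *)
Lemma independent_blocks (U : nat -> nat -> {RV P >-> R}) :
  independent_systems P (fun k => sigma_of (fun j => U k j : T -> R)) ->
  (forall k, independent_rvs (U k)) -> independent_rvs (entries U).
Proof.
move=> iU iUk s A us sA.
pose L := undup (map fst s).
pose col k := [seq i.2 | i <- s & i.1 == k].
have mcol k j : (j \in col k) = ((k, j) \in s).
  apply/mapP/idP => [[[k' j']]|kjs].
    by rewrite mem_filter => /andP[/eqP/= -> ?] ->.
  by exists (k, j) => //; rewrite mem_filter eqxx.
pose C k := \bigcap_(j in [set` col k]) A (k, j).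
have colA k j : j \in col k ->
    preimage_set_system setT (U k j) (@measurable _ R) (A (k, j)).
  by rewrite mcol => /sA.
have -> : \bigcap_(i in [set` s]) A i = \bigcap_(k in [set` L]) C k.
  apply/seteqP; split => w h.
    by move=> k /= _ j /=; rewrite mcol => ?; exact: h.
  move=> [k j] kjs; apply: (h k) => /=; last by rewrite mcol.
  by rewrite mem_undup; apply/mapP; exists (k, j).
rewrite iU ?undup_uniq//; last by move=> k _; exact: sigma_of_bigcap (colA k).
have ucol k : uniq (col k).
  rewrite map_inj_in_uniq ?filter_uniq// => -[k1 j1] [k2 j2].
  by rewrite !mem_filter/= => /andP[/eqP -> _] /andP[/eqP -> _] ->.
rewrite (eq_bigr (fun k => \prod_(i <- s | i.1 == k) P (A i))%E) => [|k _].
  rewrite (exchange_big_dep xpredT)//=; apply: eq_big_seq => -[k j] kjs.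
  have kL : k \in L by rewrite mem_undup; apply/mapP; exists (k, j).
  rewrite big_mkcond (bigD1_seq k) ?undup_uniq//= eqxx big1 ?mule1// => k'.
  by rewrite eq_sym => /negbTE ->.
rewrite (iUk k (col k) (fun j => A (k, j)))//; last exact: colA.
by rewrite big_map big_filter; apply: eq_bigr => -[k' j] /eqP/= ->.
Qed.

Lemma same_law_event (Y Z : nat -> {RV P >-> R}) j (B : set R) :
  same_law Y Z -> measurable B -> P (Y j @^-1` B) = P (Z j @^-1` B).
Proof.
move=> YZ mB; apply: (YZ [set x | B (x j)]).
by apply: sub_sigma_algebra; exists j => //; exists B => //; rewrite setTI.
Qed.

Lemma same_law_independent (Y Z : nat -> {RV P >-> R}) :
  same_law Y Z -> independent_rvs Z -> independent_rvs Y.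
Proof.
move=> YZ iZ s A us sA.
have /choice[B BP] : forall j, exists B : set R,
    measurable B /\ (j \in s -> A j = Y j @^-1` B).
  move=> j; have [js|_] := boolP (j \in s); last by exists setT.
  by have [B mB <-] := sA j js; exists B; rewrite setTI.
have mB j : measurable (B j) by case: (BP j).
have -> : \bigcap_(j in [set` s]) A j = \bigcap_(j in [set` s]) Y j @^-1` B j.
  by apply: eq_bigcapr => j js; case: (BP j) => _ ->.
transitivity (P (\bigcap_(j in [set` s]) Z j @^-1` B j)).
  apply: (YZ (\bigcap_(j in [set` s]) [set x | B j (x j)])).
  apply: sigma_of_bigcap => j _; exists (B j) => //; by rewrite setTI.
rewrite iZ// => [|j _]; last by exists (B j) => //; rewrite setTI.
apply: eq_big_seq => j js; have [_ ->//] := BP j.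
by rewrite (same_law_event j YZ).
Qed.

(** Row [j] of [Y] being a function of the variables attached to row [j],
    independence of the rows follows from the coalition principle. *)
Lemma independent_rows_of_family (I : eqType) (V : I -> {RV P >-> R})
    (row : I -> nat) (Y : nat -> nat -> T -> R) :
  independent_rvs V ->
  (forall k j, measurable_fun setT
    (Y k j : g_sigma_algebraType (\bigcup_(i in [set i | row i = j])
       preimage_set_system setT (V i) (@measurable _ R)) -> R)) ->
  independent_rows P Y.
Proof.
move=> iV mY n.
have sub (D : set nat) : <<s row_events Y D >> `<=`
    <<s \bigcup_(i in [set i | D (row i)])
       preimage_set_system setT (V i) (@measurable _ R) >>.
  apply: smallest_sub; first exact: smallest_sigma_algebra.
  move=> _ [[k j] Dj [B mB <-]].
  apply: sub_smallest2r (mY k j measurableT B mB).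
    exact: smallest_sigma_algebra.
  by move=> A [i ij VA]; exists i => //=; rewrite ij.
move=> A B /sub sA /sub sB.
apply: (independent_groups _ _ _ iV _ sA sB).
- by move=> i C [B' mB' <-]; exact: measurable_funPT.
- by move=> i; exists setT; rewrite ?preimage_setT ?setTI.
- move=> i _ _ [C mC <-] [D mD <-]; exists (C `&` D); first exact: measurableI.
  by rewrite !setTI.
- by apply/seteqP; split => // i [/= + in_]; rewrite in_ ltnn.
Qed.

End IndependentFamilies.

(** * Random signs and symmetric variables *)

Section RandomSigns.
Context d (T : measurableType d) (R : realType) (P : probability T R).

Lemma rademacher_ae (I : eqType) (e : I -> {RV P >-> R}) i :
  rademacher e -> {ae P, forall w, e i w = 1 \/ e i w = -1}.
Proof.
move=> [_ /(_ i)[e1 eN1]].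
have m1 (a : R) : measurable (e i @^-1` [set a]).
  by rewrite -[X in measurable X]setTI; exact: measurable_funPT.
exists (~` (e i @^-1` [set 1] `|` e i @^-1` [set -1])); split.
- by apply: measurableC; exact: measurableU.
- have half_add_half : 1 = 2^-1 + 2^-1 :> R by clear e1 eN1; lra.
  rewrite [LHS]probability_setC; last exact: measurableU.
  rewrite measureU//; last first.
    apply/seteqP; split => // w [/= -> h] {e1 eN1}; lra.
  rewrite [X in (_ - (X + _))%E]e1 [X in (_ - (_ + X))%E]eN1.
  by rewrite -EFinD -half_add_half subrr.
- by move=> w /= h [h'|h']; apply: h; [left|right].
Qed.

Lemma symmetric_sign (V : {RV P >-> R}) (s : R) (A : set R) :
  symmetric_rv V -> s = 1 \/ s = -1 -> measurable A ->
  P ((fun w => s * V w) @^-1` A) = P (V @^-1` A).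
Proof.
move=> symV [->|->] mA; first by under eq_fun do rewrite mul1r.
by under eq_fun do rewrite mulN1r; rewrite symV.
Qed.

Lemma same_law_symmetric (Y Z : nat -> {RV P >-> R}) j :
  same_law Y Z -> symmetric_rv (Z j) -> symmetric_rv (Y j).
Proof.
move=> YZ symZ A mA.
have mNA : measurable ((fun x : R => - x) @^-1` A).
  by rewrite -[X in measurable X]setTI; exact: oppr_measurable.
rewrite (same_law_event j YZ mA) symZ//.
rewrite -[RHS]/(P (Y j @^-1` ((fun x : R => - x) @^-1` A))).
by rewrite (same_law_event j YZ mNA).
Qed.

Context (I : countType) (Y e : I -> {RV P >-> R}).
Notation space := (g_sigma_algebraType (coordinate_events R I)).
Local Open Scope ereal_scope.

(** Conditionally on the signs, multiplying independent symmetric variables by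
    fixed signs changes neither their independence nor their marginals, hence not
    their joint law.  The index type is countable so that almost surely all the
    signs are [1] or [-1] simultaneously. *)
Lemma integral_random_signs (g : space -> R) :
  independent_rvs Y -> (forall i, symmetric_rv (Y i)) -> rademacher e ->
  independent_pair P (sigma_of (fun i => Y i : T -> R))
                     (sigma_of (fun i => e i : T -> R)) ->
  measurable_fun setT g -> (forall x, (0 <= g x)%R) ->
  \int[P]_w (g (fun i => Y i w))%:E =
  \int[P]_w (g (fun i => e i w * Y i w)%R)%:E.
Proof.
move=> iY symY rade Ye mg g0.
have gen_meas (V : I -> {RV P >-> R}) :
    \bigcup_(i in [set: I]) preimage_set_system setT (V i) (@measurable _ R)
    `<=` measurable.
  by move=> _ [i _ [B mB <-]]; exact: measurable_funPT.
pose h (z : T * T) := g (fun i => e i z.2 * Y i z.1)%R.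
have h0 z : (0 <= h z)%R by exact: g0.
have mh d1 d2 (T1 : measurableType d1) (T2 : measurableType d2)
    (Y' : I -> T1 -> R) (e' : I -> T2 -> R) :
    (forall i, measurable_fun setT (Y' i)) ->
    (forall i, measurable_fun setT (e' i)) ->
    measurable_fun setT (fun z : T1 * T2 =>
      g (fun i => e' i z.2 * Y' i z.1)%R).
  move=> mY' me'.
  have mprod i : measurable_fun setT
      (fun z : T1 * T2 => e' i z.2 * Y' i z.1)%R.
    apply: measurable_funM.
      exact: measurableT_comp (me' i) measurable_snd.
    exact: measurableT_comp (mY' i) measurable_fst.
  exact: measurableT_comp mg (measurable_family mprod).
rewrite [RHS](@integral_independent _ _ _ P _ _ h
  (gen_meas Y) (gen_meas e) Ye)//; last first.
  by apply: (mh _ _ (g_sigma_algebraType _) (g_sigma_algebraType _)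
    (fun i => Y i) (fun i => e i)) => i _ A mA;
    apply: sub_sigma_algebra; exists i => //; exists A.
have flip w1 : (forall i, e i w1 = 1 \/ e i w1 = -1)%R ->
    \int[P]_w (h (w, w1))%:E = \int[P]_w (g (fun i => Y i w))%:E.
  move=> e1.
  have mV i : measurable_fun setT (fun w => e i w1 * Y i w)%R.
    exact: measurable_funM.
  pose V i : {RV P >-> R} := mfun_Sub (mem_set (mV i)).
  apply: (@integral_independent_family _ _ _ P I V Y g) => //.
  - move=> s A us sA; apply: iY => // i /sA[B mB <-].
    exists ((fun x => e i w1 * x)%R @^-1` B) => //.
    by rewrite -[X in measurable X]setTI; exact: mulrl_measurable.
  - by move=> i A mA; exact: symmetric_sign.
transitivity (\int[P]__ \int[P]_w (g (fun i => Y i w))%:E).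
  by have := integral_cst P measurableT (\int[P]_w (g (fun i => Y i w))%:E);
    rewrite [X in _ * X](@probability_setT _ _ _ P) mule1.
apply: ae_eq_integral => //.
- apply: (measurable_fun_fubini_tonelli_G (fun z => (h z)%:E)) => //.
  by apply/measurable_EFinP;
    apply: (mh _ _ T T (fun i => Y i) (fun i => e i)).
- have aeS : {ae P, forall w, forall n i, choice.unpickle n = Some i ->
      (e i w = 1 \/ e i w = -1)%R}.
    apply: ae_foralln => n; case: choice.unpickle => [i|].
      by apply: filterS (rademacher_ae i rade) => w ei _ [<-].
    exact: aeW.
  apply: filterS aeS => w1 e1 _; apply/esym/flip => i.
  exact: e1 (choice.pickleK i).
Qed.

End RandomSigns.

(** * Comparison of the two random polynomials *)

Lemma tetrahedral_vanishing (R : realType) (E : completeNormedModType R)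
    (f : coef_family E) :
  tetrahedral f -> vanishing_on_diagonals f.
Proof.
move=> tf a i k l kl ikl; apply/eqP; apply: contraNT kl => /tf[_ mono].
case: (ltngtP (val k) (val l)) => [/mono|/mono|/val_inj ->//].
  by rewrite ikl ltnn.
by rewrite ikl ltnn.
Qed.

Section Decoupling.
Context (R : realType) (E : completeNormedModType R) (phi : R -> R)
  (mu : nat -> probability R R) (d : measure_display) (T : measurableType d)
  (P : probability T R)
  (X : nat -> {RV P >-> R}) (XX SS : nat -> nat -> {RV P >-> R}).
Hypotheses (phi_ge0 : forall t : R, 0 <= t -> 0 <= phi t)
  (phi_meas : measurable_fun (`[0, +oo[%classic : set R) phi)
  (X_indep : independent_rvs X)
  (X_law : forall j, has_law (X j) (mu j))
  (X_sym : forall j, symmetric_rv (X j))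
  (XX_copies : independent_copies X XX)
  (SS_rademacher : rademacher (entries SS))
  (SS_indep : independent_matrices SS (prepend_column X XX)).

Lemma independent_entries_XX : independent_rvs (entries XX).
Proof.
apply: independent_blocks; first exact: XX_copies.1.
by move=> k; apply: same_law_independent X_indep; exact: XX_copies.2.
Qed.

Lemma independent_rows_XX c : independent_rows P (scaled_matrix c XX).
Proof.
apply: (@independent_rows_of_family _ _ _ _ _ (entries XX) snd
  _ independent_entries_XX) => k j.
apply: measurable_funM; first exact: measurable_cst.
by move=> _ A mA; apply: sub_sigma_algebra; exists (k, j) => //; exists A.
Qed.

Lemma independent_pair_SS_X :
  independent_pair P (sigma_of (fun j => X j : T -> R))
    (sigma_of (fun kj => entries SS kj : T -> R)).
Proof.
move=> A B XA SB; rewrite setIC muleC; apply: SS_indep SB _.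
exact: (sigma_of_reindex
  (Y := fun kj => entries (prepend_column X XX) kj : T -> R)
  (s := pair 0%N)) XA.
Qed.

(** The family is indexed by the components of [X] and the signs together; both
    the variable [X j] and the signs [SS k j] are attached to row [j]. *)
Lemma independent_rows_XS : independent_rows P (row_product X SS).
Proof.
pose row (i : nat + nat * nat) :=
  match i with inl j => j | inr kj => kj.2 end.
apply: (@independent_rows_of_family _ _ _ _ _ _ row _
  (independent_rvs_sum X_indep SS_rademacher.1 independent_pair_SS_X)) => k j.
apply: measurable_funM => _ A mA; apply: sub_sigma_algebra.
  by exists (inl j) => //; exists A.
by exists (inr (k, j)) => //; exists A.
Qed.

Lemma measurable_row_product k j : measurable_fun setT (row_product X SS k j).
Proof. exact: measurable_funM. Qed.

Lemma measurable_scaled_matrix c k j :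
  measurable_fun setT (scaled_matrix c XX k j).
Proof. by apply: measurable_funM; first exact: measurable_cst. Qed.

Lemma law_XX k j : has_law (XX k j) (mu j).
Proof.
by move=> A mA; rewrite -X_law//; exact: (same_law_event j (XX_copies.2 k) mA).
Qed.

Lemma independent_row_XX j : independent_rvs (fun k => XX k j).
Proof.
apply: (independent_rvs_reindex (s := fun k => (k, j)) _ independent_entries_XX).
by move=> k l [].
Qed.

Lemma rademacher_row_SS j : rademacher (fun k => SS k j).
Proof.
have [iS lawS] := SS_rademacher; split=> [|k]; last exact: lawS (k, j).
apply: (independent_rvs_reindex (s := fun k => (k, j)) _ iS).
by move=> k l [].
Qed.

Lemma independent_row_SS_X j :
  independent_pair P (sigma_of (fun i => SS i j : T -> R))
                     (sigma_of (fun _ : unit => X j : T -> R)).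
Proof.
move=> A B SA XB; rewrite setIC muleC; apply: independent_pair_SS_X.
  exact: (sigma_of_reindex (Y := fun j => X j : T -> R) (s := fun=> j)) XB.
exact: (sigma_of_reindex (Y := fun kj => entries SS kj : T -> R)
  (s := fun i => (i, j))) SA.
Qed.

Context (f : coef_family E).
Hypothesis f_fin : finitely_supported f.

Lemma E_phi_poly_signs c :
  E_phi_poly P phi f (scaled_matrix c XX) =
  E_phi_poly P phi f (scaled_entrywise_product c SS XX).
Proof.
rewrite /E_phi_poly unlock.
apply: (@integral_random_signs _ _ _ P _ (entries XX) (entries SS)
  (fun x => phi `|P_poly f (fun k j => c * x (k, j))|)) => //.
- exact: independent_entries_XX.
- by move=> -[k j]; apply: same_law_symmetric (X_sym j); exact: XX_copies.2.
- move=> A B XA SB; rewrite setIC muleC; apply: SS_indep SB _.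
  exact: (sigma_of_reindex
    (Y := fun kj => entries (prepend_column X XX) kj : T -> R)
    (s := fun kj => (kj.1.+1, kj.2))) XA.
- apply: (measurable_phi_P_poly f_fin phi_meas) => k j.
  apply: measurable_funM; first exact: measurable_cst.
  exact: measurable_coordinate.
- by move=> x; exact: phi_ge0.
Qed.

Hypothesis f_diag : vanishing_on_diagonals f.

(** Row [n] of the matrix with entries [X_n eps_k] is, against vectors [xs], the
    sum [X_n *: \sum_k eps_k *: xs k] of the definition of the class. *)
Lemma upper_decoupling_diag c :
  R_U_with_constant E mu phi c -> upper_decoupling phi c X XX SS f.
Proof.
move=> [c0 hU]; split; last exact: E_phi_poly_signs.
apply: E_phi_poly_le => //.
- exact: measurable_row_product.
- exact: measurable_scaled_matrix.
- exact: independent_rows_XS.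
- exact: independent_rows_XX.
move=> n K x xs.
have -> : (fun w => phi `|x + \sum_(k < K) row_product X SS k n w *: xs k|) =
    (fun w => phi `|x + X n w *: \sum_(k < K) SS k n w *: xs k|).
  apply/funext => w; rewrite scaler_sumr; congr (phi `|_ + _|).
  by apply: eq_bigr => k _; rewrite scalerA.
have -> : (fun w => phi `|x + \sum_(k < K) scaled_matrix c XX k n w *: xs k|) =
    (fun w => phi `|x + c *: \sum_(k < K) XX k n w *: xs k|).
  apply/funext => w; rewrite scaler_sumr; congr (phi `|_ + _|).
  by apply: eq_bigr => k _; rewrite scalerA.
exact: (hU d T P n (X n) (fun k => XX k n) (fun k => SS k n) (X_law n)
  (@independent_row_XX n) (fun k => @law_XX k n) (rademacher_row_SS n)
  (@independent_row_SS_X n) x K (fun k => xs k)).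
Qed.

(** The vectors are scaled by [c^-1], which moves the constant of the class from
    one side of its inequality to the other. *)
Lemma lower_decoupling_diag c :
  R_L_with_constant E mu phi c -> lower_decoupling phi c X XX SS f.
Proof.
move=> [c0 hL]; split; last exact: E_phi_poly_signs.
apply: E_phi_poly_le => //.
- exact: measurable_scaled_matrix.
- exact: measurable_row_product.
- exact: independent_rows_XX.
- exact: independent_rows_XS.
move=> n K x xs.
have -> : (fun w =>
      phi `|x + \sum_(k < K) scaled_matrix c^-1 XX k n w *: xs k|) =
    (fun w => phi `|x + \sum_(k < K) XX k n w *: (c^-1 *: xs k)|).
  apply/funext => w; congr (phi `|_ + _|).
  by apply: eq_bigr => k _; rewrite scalerA mulrC.
have -> : (fun w => phi `|x + \sum_(k < K) row_product X SS k n w *: xs k|) =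
    (fun w => phi `|x + (c * X n w) *:
                        \sum_(k < K) SS k n w *: (c^-1 *: xs k)|).
  apply/funext => w; rewrite scaler_sumr; congr (phi `|_ + _|).
  apply: eq_bigr => k _; rewrite !scalerA; congr (_ *: _).
  by rewrite /row_product; field; rewrite lt0r_neq0.
exact: (hL d T P n (X n) (fun k => XX k n) (fun k => SS k n) (X_law n)
  (@independent_row_XX n) (fun k => @law_XX k n) (rademacher_row_SS n)
  (@independent_row_SS_X n) x K (fun k => c^-1 *: xs k)).
Qed.

End Decoupling.

Unset Implicit Arguments.

Theorem proposition3p7 (R : realType) (E : completeNormedModType R)
    (phi : R -> R)
    (phi_ge0 : forall t : R, 0 <= t -> 0 <= phi t)
    (phi_meas : measurable_fun (`[0, +oo[%classic : set R) phi)
    (mu : nat -> probability R R)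
    (d : measure_display) (T : measurableType d) (P : probability T R)
    (X : nat -> {RV P >-> R}) (XX SS : nat -> nat -> {RV P >-> R})
    (X_indep : independent_rvs X)
    (X_law : forall j, has_law (X j) (mu j))
    (X_sym : forall j, symmetric_rv (X j))
    (XX_copies : independent_copies X XX)
    (SS_rademacher : rademacher (entries SS))
    (SS_indep : independent_matrices SS (prepend_column X XX))
    (c : R) :
  (R_U_with_constant E mu phi c ->
     (forall f : coef_family E,
        finitely_supported f -> symmetric_family f ->
        vanishing_on_diagonals f ->
        upper_decoupling phi c X XX SS f) /\
     (convex_function (`[0, +oo[%classic : set R) phi ->
      forall f : coef_family E,
        finitely_supported f -> tetrahedral f ->
        upper_decoupling phi c X XX SS f)) /\
  (R_L_with_constant E mu phi c ->
     (forall f : coef_family E,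
        finitely_supported f -> symmetric_family f ->
        vanishing_on_diagonals f ->
        lower_decoupling phi c X XX SS f) /\
     (convex_function (`[0, +oo[%classic : set R) phi ->
      (forall f : coef_family E,
         finitely_supported f -> tetrahedral f ->
         lower_decoupling phi c X XX SS f) ->
      forall f : coef_family E,
        finitely_supported f -> symmetric_family f ->
        vanishing_on_diagonals f ->
        lower_decoupling phi c X XX SS f)).
Proof.
split=> [hU|hL]; split.
- by move=> f ffin _ fdiag; exact: (upper_decoupling_diag (mu := mu)).
- move=> _ f ffin /tetrahedral_vanishing fdiag.
  exact: (upper_decoupling_diag (mu := mu)).
- by move=> f ffin _ fdiag; exact: (lower_decoupling_diag (mu := mu)).
- by move=> _ _ f ffin _ fdiag; exact: (lower_decoupling_diag (mu := mu)).
Qed.
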